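(* Let $\omega\in L^{1,n-1}_{]s_{\min},s_{\max}[}(\mathbb{R}_+)$ be positive and, additionally, $n$-times continuously differentiable, with $[1,n+1]\subset{]s_{\min},s_{\max}[}$. Let $K_{\mathrm{ev}}^{(n)}[\omega]$ be the eigenvalue kernel and $p_l[\omega]$, $q_l[\omega]$, $K_{\mathrm{sv}}^{(n)}[\omega]$ the polynomials, bi-orthogonal functions and kernel of the squared singular values, as defined in the context. Then, for $a,a_b,a_c\in\mathbb{R}_+$: (a) the polynomials are $$p_l([\omega];a)=\int_0^\infty\Bigl(\int_{-\pi}^\pi(ae^{\imath\varphi}-r^2)^l\,K_{\mathrm{ev}}^{(n)}([\omega];r,re^{-\imath\varphi})\,d\varphi\Bigr)r\,dr,\qquad l=0,\ldots,n-1;$$ (b) the functions bi-orthogonal to these polynomials are $$q_l([\omega];a)=\frac1{2\,l!}(-\partial_a)^l\Bigl(\int_{-\pi}^\pi e^{\imath l\varphi}\,K_{\mathrm{ev}}^{(n)}([\omega];\sqrt a,\sqrt a\,e^{-\imath\varphi})\,d\varphi\Bigr),\qquad l=0,\ldots,n-1;$$ (c) the kernel is $$K_{\mathrm{sv}}^{(n)}([\omega];a_b,a_c)=\frac1{2(n-1)!}\,\partial_{a_c}^n\Bigl[\int_0^{a_c}\Bigl(\int_{-\pi}^\pi K_{\mathrm{ev}}^{(n)}([\omega];\sqrt x,\sqrt x\,e^{-\imath\varphi})(a_c-a_be^{\imath\varphi})^{n-1}d\varphi\Bigr)dx\Bigr]$$ $$=-\frac1{2(n-1)!}\,\partial_{a_c}^n\Bigl[\int_{a_c}^\infty\Bigl(\int_{-\pi}^\pi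 K_{\mathrm{ev}}^{(n)}([\omega];\sqrt x,\sqrt x\,e^{-\imath\varphi})(a_c-a_be^{\imath\varphi})^{n-1}d\varphi\Bigr)dx\Bigr].$$
   Context: Fix $n\in\mathbb{N}$, $\mathbb{R}_+=(0,\infty)$. $\mathcal{M}\omega(s)=\int_0^\infty\omega(y)y^{s-1}dy$ is the Mellin transform. ''Positive'' means non-negative and (so that the ensemble is normalizable) not almost everywhere zero. For an interval $\mathbb{I}\ni1$, $L^{1,k}_{\mathbb{I}}(\mathbb{R}_+)$ is the set of $f\in L^1(\mathbb{R}_+)$ that are $k$-times differentiable (i.e. $(k-1)$-times continuously differentiable with $(k-1)$-th derivative absolutely continuous on compact subintervals) with $\int_0^\infty|y^{\kappa-1}(-y\partial_y)^jf(y)|\,dy<\infty$ for all $\kappa\in\mathbb{I}$, $j=0,\ldots,k$. $]s_{\min},s_{\max}[$ denotes the open interval. The underlying ensemble is the bi-unitarily invariant ensemble on $\mathrm{GL}(n,\mathbb{C})$ whose eigenvalues have joint density proportional to $|\Delta_n(z)|^2\prod_j\omega(|z_j|^2)$ and whose squared singular values have joint (possibly signed) density proportional to $\Delta_n(a)\det[(-a_k\partial_{a_k})^{j-1}\omega(a_k)]_{j,k=1,\ldots,n}$, with $\Delta_n(x)=\prod_{b<c}(x_c-x_b)$. Eigenvalue kernel (second argument $w=\bar z'$): $$K_{\mathrm{ev}}^{(n)}([\omega];z,w)=\sqrt{\omega(|z|^2)\omega(|w|^2)}\sum_{j=0}^{n-1}\frac{(zw)^j}{\pi\,\mathcal{M}\omega(j+1)}.$$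 Quantities for the squared singular values, for $l=0,\ldots,n-1$: $$p_l([\omega];a)=\sum_{j=0}^l(-1)^{l-j}\frac{l!\,\mathcal{M}\omega(l+1)}{j!(l-j)!\,\mathcal{M}\omega(j+1)}a^j,\qquad q_l([\omega];a)=\frac1{l!\,\mathcal{M}\omega(l+1)}\,\partial_a^l\bigl[(-a)^l\omega(a)\bigr],$$ $$K_{\mathrm{sv}}^{(n)}([\omega];a_b,a_c)=\sum_{j=0}^{n-1}p_j([\omega];a_b)\,q_j([\omega];a_c).$$ *)

(* Defs.v *)
From mathcomp Require Import all_boot all_order all_algebra.
From mathcomp Require Import all_classical all_reals all_analysis.
From mathcomp Require Import complex.

Set Implicit Arguments.
Unset Strict Implicit.
Unset Printing Implicit Defensive.

Import Order.TTheory GRing.Theory Num.Theory.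
Import numFieldNormedType.Exports.

Local Open Scope ring_scope.
Local Open Scope complex_scope.
Local Open Scope classical_set_scope.

Section Defs.
Context {R : realType}.

Definition expi (phi : R) : R[i] := cos phi +i* sin phi.

Definition Cintegral (D : set R) (f : R -> R[i]) : R[i] :=
  (\int[lebesgue_measure]_(x in D) complex.Re (f x)) +i*
  (\int[lebesgue_measure]_(x in D) complex.Im (f x)).

Definition Cderiven (n : nat) (f : R -> R[i]) (x : R) : R[i] :=
  derive1n n (fun t => complex.Re (f t)) x +i*
  derive1n n (fun t => complex.Im (f t)) x.

(* All functions on R_+ = ]0, +oo[ are represented by total functions on R
   whose values outside R_+ are irrelevant. *)

Definition Ck (k : nat) (f : R -> R) : Prop :=
  (forall j, (j < k)%N -> forall y, 0 < y -> derivable (derive1n j f) y 1) /\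
  (forall y, 0 < y -> {for y, continuous (derive1n k f)}).

(* [u i, v i], i < m, range over finite families of non-overlapping
   subintervals of [a, b]. *)
Definition abs_continuous (a b : R) (f : R -> R) : Prop :=
  forall e : R, 0 < e -> exists2 d : R, 0 < d &
    forall (m : nat) (u v : 'I_m -> R),
      (forall i, [/\ a <= u i, u i <= v i & v i <= b]) ->
      (forall i j, i != j -> v i <= u j \/ v j <= u i) ->
      \sum_(i < m) (v i - u i) < d ->
      \sum_(i < m) `|f (v i) - f (u i)| < e.

(* C^(k-1) with locally absolutely continuous (k-1)-th derivative;
   no condition when k = 0 *)
Definition times_differentiable (k : nat) (f : R -> R) : Prop :=
  if k is k'.+1 then
    Ck k' f /\
    (forall a b, 0 < a -> a <= b -> abs_continuous a b (derive1n k' f))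
  else True.

(* (- y d/dy)^j f *)
Definition euler (j : nat) (f : R -> R) : R -> R :=
  iter j (fun g y => - y * derive1 g y) f.

(* For j = k the (k-1)-th derivative is differentiable only almost everywhere;
   the value of [derive1] on the exceptional null set does not matter. *)
Definition L1k (k : nat) (I : set R) : set (R -> R) :=
  [set f : R -> R | [/\ lebesgue_measure.-integrable `]0, +oo[ (EFin \o f),
     times_differentiable k f &
     forall kappa j, I kappa -> (j <= k)%N ->
       lebesgue_measure.-integrable `]0, +oo[
         (EFin \o (fun y => y `^ (kappa - 1) * euler j f y))]].

Definition open_itv (smin smax : \bar R) : set R :=
  [set s | (smin < s%:E)%E /\ (s%:E < smax)%E].

Definition positive_weight (f : R -> R) : Prop :=
  (forall y, 0 < y -> 0 <= f y) /\
  ~ {ae lebesgue_measure, forall y, 0 < y -> f y = 0}.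

Variable omega : R -> R.

Definition mellin (s : R) : R :=
  \int[lebesgue_measure]_(y in `]0, +oo[) (omega y * y `^ (s - 1)).

Definition K_ev (n : nat) (z w : R[i]) : R[i] :=
  (Num.sqrt (omega (Normc.normc z ^+ 2) * omega (Normc.normc w ^+ 2)))%:C *
  \sum_(j < n) (z * w) ^+ j / (pi * mellin j.+1%:R)%:C.

Definition p_sv (l : nat) (a : R) : R :=
  \sum_(j < l.+1) (-1) ^+ (l - j) *
    ((l`!)%:R * mellin l.+1%:R) /
    ((j`!)%:R * ((l - j)`!)%:R * mellin j.+1%:R) * a ^+ j.

Definition q_sv (l : nat) (a : R) : R :=
  ((l`!)%:R * mellin l.+1%:R)^-1 *
  derive1n l (fun x => (- x) ^+ l * omega x) a.

Definition K_sv (n : nat) (b c : R) : R :=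
  \sum_(j < n) p_sv j b * q_sv j c.

End Defs.

(* Main.v *)
Require Import Defs.
From mathcomp Require Import all_boot all_order all_algebra.
From mathcomp Require Import all_classical all_reals all_analysis.
From mathcomp Require Import complex.
From mathcomp Require Import measurable_realfun ring lra.

Set Implicit Arguments.
Unset Strict Implicit.
Unset Printing Implicit Defensive.

Import Order.TTheory GRing.Theory Num.Theory.
Import numFieldNormedType.Exports.

Local Open Scope ring_scope.
Local Open Scope complex_scope.
Local Open Scope classical_set_scope.

(** On the circle of radius [r] the eigenvalue kernel is a trigonometric
    polynomial,
      K_ev (r, r e^{-i phi}) =
        omega(r^2) sum_(j < n) r^{2j} e^{-i j phi} / (pi M(j+1)),
    the square root disappearing because [omega >= 0].  Integrating it over
    [phi] against a polynomial of degree [< n] in [e^{i phi}] therefore just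
    sums the coefficients of that polynomial, the k-th one with weight
    [2 omega(r^2) r^{2k} / M(k+1)] ([Cintegral_angular],
    [K_ev_circle_integral]); every inner integral of the theorem is of this
    shape, for a binomial [(u e^{i phi} + v)^l].

    For the polynomials [p_l], all the terms carry the same radial factor
    [2 r^{2l+1} omega(r^2)], whose integral is [M(l+1)] by the substitution
    [x = r^2] ([Rintegral_sqr_pos]).  For [q_l], only the term [k = l]
    survives, and [q_l] is by definition a multiple of its l-th derivative.

    For the kernel, let [W_k] be any antiderivative of [t^k omega(t)].  The
    sum over [j] defining [K_sv], ordered by powers of [b], has coefficients
      sum_(i < n - k) (d/dc)^{k+i} [c^{k+i} omega(c)] / i!,
    and the identity carrying the proof is that this sum telescopes:
      (d/dt)^{m+k+1} [t^m/m! W_k]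
        = (d/dt)^{m+k} [t^{m-1}/(m-1)! W_k] + (d/dt)^{m+k} [t^{m+k} omega] / m!
    so that it equals the n-th derivative of [t^{n-1-k}/(n-1-k)! W_k]
    ([derive1n_antiderivative], [K_sv_primitive]).  Taking for [W_k] the
    integral of [x^k omega] over [(0, t)], or minus its integral over
    [(t, oo)], gives the two formulas.  Cancelling [M(j+1)] in [p_j q_j] needs
    [M(j+1) != 0], which is where [omega] not vanishing almost everywhere
    enters ([mellin_nat_neq0]). *)

(** * Complex-valued integrals *)

Section ComplexIntegral.
Context {R : realType}.
Local Notation mu := (@lebesgue_measure R).
Implicit Types (D : set R) (f g : R -> R[i]).

Definition Cintegrable D f :=
  mu.-integrable D (EFin \o (fun x => complex.Re (f x))) /\
  mu.-integrable D (EFin \o (fun x => complex.Im (f x))).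

Lemma eq_Cintegral D f g : {in D, f =1 g} -> Cintegral D f = Cintegral D g.
Proof.
by move=> fg; rewrite /Cintegral; congr (_ +i* _); apply: eq_Rintegral => x xD;
  rewrite fg.
Qed.

Lemma Cintegral_real D (f : R -> R) :
  Cintegral D (fun x => (f x)%:C) = (\int[mu]_(x in D) f x)%:C.
Proof.
by rewrite /Cintegral/=; congr (_ +i* _); rewrite /Rintegral integral0.
Qed.

Lemma ReZ (c : R) (z : R[i]) : complex.Re (c%:C * z) = c * complex.Re z.
Proof. by case: z => a b /=; rewrite mul0r subr0. Qed.

Lemma ImZ (c : R) (z : R[i]) : complex.Im (c%:C * z) = c * complex.Im z.
Proof. by case: z => a b /=; rewrite mul0r addr0. Qed.

Lemma CintegrableZl D (c : R) f : measurable D -> Cintegrable D f ->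
  Cintegrable D (fun x => c%:C * f x).
Proof.
move=> mD [f1 f2]; split.
- rewrite (_ : _ \o _ = (fun x => c%:E * (complex.Re (f x))%:E)%E).
    exact: integrableZl.
  by apply/funext => x /=; rewrite ReZ.
- rewrite (_ : _ \o _ = (fun x => c%:E * (complex.Im (f x))%:E)%E).
    exact: integrableZl.
  by apply/funext => x /=; rewrite ImZ.
Qed.

Lemma CintegralZl D (c : R) f : measurable D -> Cintegrable D f ->
  Cintegral D (fun x => c%:C * f x) = c%:C * Cintegral D f.
Proof.
move=> mD [f1 f2]; apply/eqP; rewrite eq_complex ReZ ImZ /=.
under eq_Rintegral do rewrite ReZ.
under [X in _ && (X == _)]eq_Rintegral do rewrite ImZ.
by rewrite !RintegralZl// !eqxx.
Qed.

Lemma ReD (z w : R[i]) : complex.Re (z + w) = complex.Re z + complex.Re w.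
Proof. by case: z w => [a b] [c d]. Qed.

Lemma ImD (z w : R[i]) : complex.Im (z + w) = complex.Im z + complex.Im w.
Proof. by case: z w => [a b] [c d]. Qed.

Lemma CintegrableD D f g : measurable D -> Cintegrable D f ->
  Cintegrable D g -> Cintegrable D (fun x => f x + g x).
Proof.
move=> mD [f1 f2] [g1 g2]; split.
- rewrite (_ : _ \o _ = (EFin \o (fun x => complex.Re (f x))) \+
     (EFin \o (fun x => complex.Re (g x))))%E; first exact: integrableD.
  by apply/funext => x /=; rewrite ReD.
- rewrite (_ : _ \o _ = (EFin \o (fun x => complex.Im (f x))) \+
     (EFin \o (fun x => complex.Im (g x))))%E; first exact: integrableD.
  by apply/funext => x /=; rewrite ImD.
Qed.

Lemma CintegralD D f g : measurable D -> Cintegrable D f -> Cintegrable D g ->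
  Cintegral D (fun x => f x + g x) = Cintegral D f + Cintegral D g.
Proof.
move=> mD [f1 f2] [g1 g2]; apply/eqP; rewrite eq_complex ReD ImD /=.
under eq_Rintegral do rewrite ReD.
under [X in _ && (X == _)]eq_Rintegral do rewrite ImD.
by rewrite !RintegralD// !eqxx.
Qed.

Lemma Cintegrable0 D : Cintegrable D (fun=> 0).
Proof. by split; exact: integrable0. Qed.

Lemma Cintegral_sum D (I : Type) (s : seq I) (F : I -> R -> R[i]) :
  measurable D -> (forall i, Cintegrable D (F i)) ->
  Cintegrable D (fun x => \sum_(i <- s) F i x) /\
  Cintegral D (fun x => \sum_(i <- s) F i x) =
  \sum_(i <- s) Cintegral D (F i).
Proof.
move=> mD iF; elim: s => [|i s [IH1 IH2]].
  rewrite big_nil (_ : (fun _ => _) = (fun=> 0)).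
    by split; [exact: Cintegrable0|rewrite Cintegral_real /Rintegral integral0].
  by apply/funext => x; rewrite big_nil.
rewrite big_cons -IH2.
rewrite (_ : (fun _ => _) = (fun x => F i x + \sum_(i <- s) F i x)).
  by split; [exact: CintegrableD|rewrite CintegralD].
by apply/funext => x; rewrite big_cons.
Qed.

End ComplexIntegral.

(** * Fourier orthogonality on a circle *)

Section Fourier.
Context {R : realType}.
Local Notation mu := (@lebesgue_measure R).

Lemma expiD (x y : R) : expi (x + y) = expi x * expi y.
Proof.
by apply/eqP; rewrite /expi eq_complex/= cosD sinD eqxx/= addrC eqxx.
Qed.

Lemma expiMn (x : R) k : expi (k%:R * x) = expi x ^+ k.
Proof.
elim: k => [|k IH]; first by rewrite mul0r /expi cos0 sin0.
by rewrite mulrSr mulrDl mul1r expiD IH exprSr.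
Qed.

Lemma sin_natpi k : sin (k%:R * pi) = 0 :> R.
Proof.
elim: k => [|k IH]; first by rewrite mul0r sin0.
by rewrite mulrSr mulrDl mul1r sinDpi IH oppr0.
Qed.

Lemma Rintegral_FTC (f F : R -> R) (a b : R) : a < b ->
  (forall x : R, is_derive x (1 : R) F (f x)) -> continuous f ->
  \int[mu]_(x in `[a, b]) f x = F b - F a.
Proof.
move=> ab dF cf; have cF : continuous F.
  by move=> x; apply/differentiable_continuous/derivable1_diffP; case: (dF x).
rewrite /Rintegral (@continuous_FTC2 _ _ F)//.
- exact: continuous_subspaceT.
- split => [x _||]; first by case: (dF x).
  + exact/cvg_at_right_filter/cF.
  + exact/cvg_at_left_filter/cF.
- by move=> x _; rewrite derive1E; case: (dF x).
Qed.

Lemma continuous_itv_integrable (f : R -> R) (a b : R) : continuous f ->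
  mu.-integrable `[a, b] (EFin \o f).
Proof.
move=> cf; apply: continuous_compact_integrable.
  exact: segment_compact.
exact: continuous_subspaceT.
Qed.

Lemma Cintegrable_expi (c a b : R) :
  Cintegrable `[a, b] (fun phi => expi (c * phi)).
Proof.
by split; apply: continuous_itv_integrable => x /=;
 apply: continuous_comp; [exact: mulrl_continuous|exact: continuous_cos
  |exact: mulrl_continuous|exact: continuous_sin].
Qed.

Lemma Cintegral_expi_eq0 (c : R) : c != 0 -> sin (c * pi) = 0 ->
  Cintegral `[- pi, pi] (fun phi => expi (c * phi)) = 0.
Proof.
move=> c0 sc; have pipi : - pi < pi :> R by have := @pi_gt0 R; lra.
have cc : continuous (fun x : R => cos (c * x)).
  by move=> x; apply: continuous_comp; [exact: mulrl_continuous|exact: continuous_cos].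
have cs : continuous (fun x : R => sin (c * x)).
  by move=> x; apply: continuous_comp; [exact: mulrl_continuous|exact: continuous_sin].
have ds (x : R) : is_derive x (1 : R) (fun x => c^-1 * sin (c * x)) (cos (c * x)).
  apply: is_derive_eq; rewrite /= /GRing.scale/=.
  by field.
have dc (x : R) : is_derive x (1 : R) (fun x => - c^-1 * cos (c * x)) (sin (c * x)).
  apply: is_derive_eq; rewrite /= /GRing.scale/=.
  by field.
rewrite /Cintegral /= (Rintegral_FTC pipi ds cc) (Rintegral_FTC pipi dc cs).
by rewrite !mulrN sinN cosN sc oppr0 !subrr.
Qed.

Lemma expi_powM (k j : nat) (phi : R) :
  expi phi ^+ k * expi (- phi) ^+ j = expi ((k%:R - j%:R) * phi).
Proof. by rewrite -!expiMn -expiD mulrN mulrBl. Qed.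

(** The constant mode contributes the length of the circle; any other mode
    has an antiderivative taking equal values at [-pi] and [pi]. *)
Lemma expi_orthogonal (k j : nat) :
  Cintegral `[- pi, pi] (fun phi : R => expi phi ^+ k * expi (- phi) ^+ j) =
  (2 * pi *+ (k == j))%:C.
Proof.
under eq_Cintegral do rewrite expi_powM.
case: eqVneq => [->|kj].
  rewrite subrr; under eq_Cintegral => x _.
    have -> : expi (0 * x) = 1%:C by rewrite mul0r /expi cos0 sin0.
    over.
  rewrite Cintegral_real Rintegral_cst//= lebesgue_measure_itv /= lte_fin.
  have := @pi_gt0 R => pi0; rewrite ifT/=; last by lra.
  by congr (_%:C); lra.
rewrite Cintegral_expi_eq0 ?mulr0n//; first by rewrite subr_eq0 eqr_nat.
by rewrite mulrBl sinB !sin_natpi !mul0r mulr0 subrr.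
Qed.

(** Multiplying out, only the pairs of opposite frequencies survive; [N <= n]
    makes sure that every mode of the first factor meets its opposite. *)
Lemma Cintegral_angular (A B : nat -> R) (N n : nat) : (N <= n)%N ->
  Cintegral `[- pi, pi] (fun phi : R =>
    (\sum_(k < N) (A k)%:C * expi phi ^+ k) *
    (\sum_(j < n) (B j)%:C * expi (- phi) ^+ j)) =
  (2 * pi * \sum_(k < N) A k * B k)%:C.
Proof.
move=> Nn.
under eq_Cintegral => phi _.
  rewrite big_distrl/=.
  under eq_bigr => k _.
    rewrite big_distrr/=.
    under eq_bigr => j _.
      have -> : (A k)%:C * expi phi ^+ k * ((B j)%:C * expi (- phi) ^+ j) =
        (A k * B j)%:C * expi ((k%:R - j%:R) * phi).
        rewrite -expi_powM rmorphM/=; ring.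
      over.
    over.
  over.
have mD : measurable (`[- pi, pi] : set R) by [].
have iC (k j : nat) : Cintegrable `[- pi, pi]
    (fun phi : R => (A k * B j)%:C * expi ((k%:R - j%:R) * phi)).
  by apply: CintegrableZl => //; exact: Cintegrable_expi.
have iS (k : nat) := @Cintegral_sum R `[- pi, pi] _ (index_enum 'I_n) _ mD
  (fun j : 'I_n => iC k j).
have [_ ->] := @Cintegral_sum R `[- pi, pi] _ (index_enum 'I_N) _ mD
  (fun k : 'I_N => (iS k).1).
rewrite mulr_sumr rmorph_sum/=; apply: eq_bigr => k _.
rewrite (iS k).2 (bigD1 (widen_ord Nn k))//= big1 => [|j jk].
  rewrite CintegralZl//; last exact: Cintegrable_expi.
  under eq_Cintegral do rewrite -expi_powM.
  by rewrite expi_orthogonal eqxx mulr1n addr0 -rmorphM/=; congr _%:C; ring.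
rewrite CintegralZl//; last exact: Cintegrable_expi.
under eq_Cintegral do rewrite -expi_powM.
rewrite expi_orthogonal (_ : (_ == _) = false) ?mulr0n ?mulr0//.
by apply: contraNF jk => /eqP kj; apply/eqP/val_inj.
Qed.

End Fourier.

(** * Iterated derivatives on the positive half-line *)

Section PositiveDerivatives.
Context {R : realType}.
Implicit Types f g h : R -> R.

(** Only differentiability is asked, not continuity of the k-th derivative, so
    that closure under products is a plain induction on [k]. *)
Definition derivable_pos k f :=
  forall j, (j < k)%N -> forall y : R, 0 < y -> derivable (derive1n j f) y 1.

Lemma derivable_pos0 f : derivable_pos 0 f.
Proof. by move=> j; rewrite ltn0. Qed.

Lemma near_pos (P : R -> Prop) : (forall y : R, 0 < y -> P y) ->
  forall x : R, 0 < x -> \forall y \near x, P y.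
Proof.
move=> h x x0; near=> y; apply: h; near: y.
by apply: lt_nbhsr.
Unshelve. all: by end_near. Qed.

(** Derivatives at a point depend on the germ only and the half-line is open,
    hence values outside it never matter. *)
Lemma derive1n_pos_eq j f g : (forall y : R, 0 < y -> f y = g y) ->
  forall y : R, 0 < y -> derive1n j f y = derive1n j g y.
Proof.
move=> fg; elim: j => [//|j IH] y y0; rewrite !derive1nS !derive1E.
by apply: near_eq_derive; exact: near_pos.
Qed.

Lemma derivable_pos_eq k f g : (forall y : R, 0 < y -> f y = g y) ->
  derivable_pos k f -> derivable_pos k g.
Proof.
move=> fg df j jk y y0; apply: near_eq_derivable (df j jk y y0).
by apply: (near_pos _ y0) => ? ?; exact: derive1n_pos_eq.
Qed.

(** The induction principle for [derivable_pos]: one derivative is exhibited,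
    and all the others are asked of it. *)
Lemma derivable_posS k f f' : (forall y : R, 0 < y -> is_derive y (1 : R) f (f' y)) ->
  derivable_pos k f' -> derivable_pos k.+1 f.
Proof.
move=> df dk [|j] jk y y0; first by case: (df y y0).
rewrite derive1Sn; apply: (derivable_pos_eq _ dk) => // x x0.
by rewrite derive1E; case: (df x x0).
Qed.

Lemma derivable_pos_derive k f : derivable_pos k.+1 f ->
  forall y : R, 0 < y -> is_derive y (1 : R) f (derive1 f y).
Proof.
by move=> df y y0; rewrite derive1E; apply/derivableP/(df 0%N).
Qed.

Lemma derivable_pos_derive1 k f : derivable_pos k.+1 f ->
  derivable_pos k (derive1 f).
Proof. by move=> df j jk y y0; rewrite -derive1Sn; exact: df. Qed.

Lemma derivable_posW k l f : (k <= l)%N -> derivable_pos l f -> derivable_pos k f.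
Proof. by move=> kl df j jk; apply: df; exact: leq_trans kl. Qed.

Lemma derivable_pos_cst k (c : R) : derivable_pos k (fun=> c).
Proof.
elim: k c => [c|k IH c]; first exact: derivable_pos0.
by apply: (@derivable_posS _ _ (fun=> 0)); exact: IH.
Qed.

Lemma derivable_posD k f g : derivable_pos k f -> derivable_pos k g ->
  derivable_pos k (fun x => f x + g x).
Proof.
elim: k f g => [f g _ _|k IH f g df dg]; first exact: derivable_pos0.
apply: (@derivable_posS _ _ (fun x => derive1 f x + derive1 g x)).
  move=> y y0; have := derivable_pos_derive df y0.
  by have := derivable_pos_derive dg y0 => ? ?; exact: is_deriveD.
by apply: IH; exact: derivable_pos_derive1.
Qed.

Lemma derivable_posM k f g : derivable_pos k f -> derivable_pos k g ->
  derivable_pos k (fun x => f x * g x).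
Proof.
elim: k f g => [f g _ _|k IH f g df dg]; first exact: derivable_pos0.
apply: (@derivable_posS _ _ (fun x => f x * derive1 g x + g x * derive1 f x)).
  move=> y y0; have := derivable_pos_derive df y0.
  by have := derivable_pos_derive dg y0 => ? ?; exact: is_deriveM.
have [df' dg'] := (derivable_pos_derive1 df, derivable_pos_derive1 dg).
have [dfk dgk] := (derivable_posW (leqnSn k) df, derivable_posW (leqnSn k) dg).
by apply: derivable_posD; exact: IH.
Qed.

Lemma derivable_pos_exp k m : derivable_pos k (fun x : R => x ^+ m).
Proof.
elim: m => [|m IH]; first exact: derivable_pos_cst.
apply: (@derivable_pos_eq _ (fun x => x * x ^+ m)).
  by move=> y _; rewrite exprS.
apply: derivable_posM; last exact: IH.
case: k {IH} => [|k]; first exact: derivable_pos0.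
by apply: (@derivable_posS _ _ (fun=> 1)); exact: derivable_pos_cst.
Qed.

Lemma derive1n_posD k f g (y : R) : derivable_pos k f -> derivable_pos k g ->
  0 < y -> derive1n k (fun x => f x + g x) y = derive1n k f y + derive1n k g y.
Proof.
elim: k f g => [f g _ _ _ //|k IH f g df dg y0]; rewrite !derive1Sn.
rewrite -IH//; try exact: derivable_pos_derive1.
apply: derive1n_pos_eq => // x x0; have := derivable_pos_derive df x0.
have := derivable_pos_derive dg x0 => dgx dfx.
by rewrite derive1E; have [_ ->] := is_deriveD dfx dgx.
Qed.

Lemma derive1n_posZ k (c : R) f (y : R) : derivable_pos k f ->
  0 < y -> derive1n k (fun x => c * f x) y = c * derive1n k f y.
Proof.
elim: k f => [f _ _ //|k IH f df y0]; rewrite !derive1Sn.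
rewrite -IH//; last exact: derivable_pos_derive1.
apply: derive1n_pos_eq => // x x0; have := derivable_pos_derive df x0.
by move=> dfx; rewrite derive1E; have [_ ->] := is_deriveZ c dfx.
Qed.

Lemma derive1n_zero k : derive1n k (fun=> 0 : R) = (fun=> 0 : R).
Proof.
elim: k => [//|k IH]; rewrite derive1Sn -{2}IH; congr (derive1n k _).
by apply/funext => x; rewrite derive1_cst.
Qed.

Lemma derivable_pos_sum k (I : Type) (s : seq I) (F : I -> R -> R) :
  (forall i, derivable_pos k (F i)) ->
  derivable_pos k (fun x => \sum_(i <- s) F i x).
Proof.
move=> dF; elim: s => [|i s IH].
  apply: (@derivable_pos_eq k (fun=> 0)); last exact: derivable_pos_cst.
  by move=> x _; rewrite big_nil.
apply: (@derivable_pos_eq k (fun x => F i x + \sum_(i <- s) F i x)).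
  by move=> x _; rewrite big_cons.
exact: derivable_posD (dF i) IH.
Qed.

Lemma derive1n_pos_sum k (I : Type) (s : seq I) (F : I -> R -> R) (y : R) :
  (forall i, derivable_pos k (F i)) -> 0 < y ->
  derive1n k (fun x => \sum_(i <- s) F i x) y = \sum_(i <- s) derive1n k (F i) y.
Proof.
move=> dF y0; elim: s => [|i s IH].
  rewrite (_ : (fun _ => _) = (fun=> 0)) ?big_nil ?derive1n_zero//.
  by apply/funext => x; rewrite big_nil.
rewrite (_ : (fun _ => _) = (fun x => F i x + \sum_(i <- s) F i x)) ?big_cons.
  by rewrite (derive1n_posD (dF i) (@derivable_pos_sum k I s F dF) y0) IH.
by apply/funext => x; rewrite big_cons.
Qed.

Lemma Cderiven_pos_real k (g : R -> R[i]) h (y : R) :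
  (forall x : R, 0 < x -> g x = (h x)%:C) -> 0 < y ->
  Cderiven k g y = (derive1n k h y)%:C.
Proof.
move=> gh y0; rewrite /Cderiven; congr (_ +i* _).
  by apply: derive1n_pos_eq => // x x0; rewrite gh.
rewrite (@derive1n_pos_eq _ _ (fun=> 0)) ?derive1n_zero// => x x0.
by rewrite gh.
Qed.

(** One application of the product rule to [t^(m+1)/(m+1)! * W] reproduces the
    same expression with [m] in place of [m+1], plus the last term of the sum;
    the remaining [m+k+1] derivatives are distributed over the two. *)
Lemma derive1n_antiderivative (omega W : R -> R) (k m : nat) (c : R) :
  derivable_pos (m + k) omega ->
  (forall t : R, 0 < t -> is_derive t (1 : R) W (t ^+ k * omega t)) -> 0 < c ->
  derive1n (m + k).+1 (fun t => t ^+ m / m`!%:R * W t) c =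
  \sum_(i < m.+1) derive1n (k + i) (fun t => t ^+ (k + i) * omega t) c / i`!%:R.
Proof.
elim: m => [|m IH] domega dW c0.
  rewrite add0n big_ord1 addn0 fact0 divr1 derive1Sn.
  apply: derive1n_pos_eq => // t t0.
  rewrite (_ : (fun _ => _) = W); last first.
    by apply/funext => x; rewrite expr0 divr1 mul1r.
  by rewrite derive1E; case: (dW t t0).
have dxo j l : (l <= m.+1 + k)%N ->
    derivable_pos l (fun t => t ^+ j * omega t).
  move=> lmk; apply: derivable_posM; first exact: derivable_pos_exp.
  exact: derivable_posW domega.
pose F (t : R) := t ^+ m / m`!%:R * W t.
pose g (t : R) := t ^+ (k + m.+1) * omega t.
have dp (t : R) : is_derive t (1 : R) (fun x : R => x ^+ m.+1 / (m.+1)`!%:R)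
    (t ^+ m / m`!%:R).
  rewrite (_ : (fun x => _) = (m.+1)`!%:R^-1 \*: (id ^+ m.+1)).
    apply: is_derive_eq; rewrite /GRing.scale/= mulr1 factS natrM.
    by field; rewrite nat1r !pnatr_eq0 -lt0n fact_gt0.
  by apply/funext => x; rewrite mulrC /GRing.scale/= exprfctE.
have dFg (t : R) : 0 < t ->
    derive1 (fun t => t ^+ m.+1 / (m.+1)`!%:R * W t) t =
    F t + (m.+1)`!%:R^-1 * g t.
  move=> t0; rewrite derive1E; have [_ ->] := is_deriveM (dp t) (dW t t0).
  by rewrite /GRing.scale/= /F /g addnC exprD; ring.
have dF : derivable_pos (m + k).+1 F.
  apply: derivable_posM; last first.
    by apply: (derivable_posS dW); apply: dxo; rewrite addSn leqnSn.
  by apply: derivable_posM; [exact: derivable_pos_exp|exact: derivable_pos_cst].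
have dg : derivable_pos (m + k).+1 g by apply: dxo; rewrite addSn.
have dcg : derivable_pos (m + k).+1 (fun t => (m.+1)`!%:R^-1 * g t).
  by apply: derivable_posM; [exact: derivable_pos_cst|exact: dg].
rewrite derive1Sn addSn (derive1n_pos_eq _ dFg c0).
rewrite (derive1n_posD dF dcg c0) (derive1n_posZ _ dg c0).
rewrite big_ord_recr/= -IH//; last by apply: derivable_posW domega; rewrite leq_add2r.
by rewrite [in RHS]mulrC /g (_ : (k + m.+1 = (m + k).+1)%N)// addnC.
Qed.

End PositiveDerivatives.

(** * The substitution x = r^2 on the positive half-line *)

Section SquareSubstitution.
Context {R : realType}.
Local Notation mu := (@lebesgue_measure R).
Implicit Types f : R -> R.

Lemma derive1_sqrt (x : R) : 0 < x -> derive1 Num.sqrt x = (2 * Num.sqrt x)^-1.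
Proof. by move=> x0; rewrite derive1E derive_sqrt. Qed.

Lemma cvg_derive1_sqrt (x : R) : 0 < x -> {for x, continuous (derive1 (@Num.sqrt R))}.
Proof.
move=> x0; rewrite /prop_for /continuous_at derive1_sqrt//.
have h : (fun y => (2 * Num.sqrt y)^-1) y @[y --> x] --> (2 * Num.sqrt x)^-1.
  apply: cvgV; first by rewrite mulf_neq0// gt_eqF// sqrtr_gt0.
  by apply: cvgMr; exact: sqrt_continuous.
apply: cvg_trans h; apply: near_eq_cvg.
by apply: (near_pos _ x0) => y y0; rewrite derive1_sqrt.
Qed.

Lemma cvgy_sqrt : @Num.sqrt R x @[x --> +oo] --> +oo.
Proof.
apply/cvgryPge => A; near=> x.
have x0 : 0 <= x by near: x; exact: nbhs_pinfty_ge.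
have [A0|A0] := leP A 0; first by rewrite (le_trans A0)// sqrtr_ge0.
rewrite -(ger0_norm (ltW A0)) -sqrtr_sqr; apply: ler_wsqrtr.
by near: x; apply: nbhs_pinfty_ge; exact: num_real.
Unshelve. all: by end_near. Qed.

Lemma measurable_pos f : (forall x : R, 0 < x -> {for x, continuous f}) ->
  measurable_fun (`]0, +oo[ : set R) f.
Proof.
move=> cf; apply: open_continuous_measurable_fun => //.
by move=> x; rewrite inE/= in_itv/= andbT; exact: cf.
Qed.

Lemma continuous_sqr_subst f (r : R) :
  (forall x : R, 0 < x -> {for x, continuous f}) -> 0 < r ->
  {for r, continuous (fun s : R => 2 * s * f (s ^+ 2))}.
Proof.
move=> cf r0; apply: cvgM; first by apply: cvgMr; exact: cvg_id.
apply: (@continuous_comp _ _ _ (fun s : R => s ^+ 2) f).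
  exact: exprn_continuous.
by apply: cf; rewrite exprn_gt0.
Qed.

(** The substitution is carried out with the increasing map [sqrt] rather than
    with the square, since its derivative converges at infinity, as the change
    of variables theorem requires; staying away from the origin is what makes
    that derivative, and [f], continuous up to the left end point. *)
Lemma integral_sqr_tail f (e : R) : (forall x : R, 0 < x -> {for x, continuous f}) ->
  (forall x : R, 0 < x -> 0 <= f x) -> 0 < e ->
  (\int[mu]_(r in `[e%R, +oo[) (2 * r * f (r ^+ 2))%R%:E =
   \int[mu]_(x in `[(e ^+ 2)%R, +oo[) (f x)%:E)%E.
Proof.
move=> cf f0 e0; have e20 : 0 < e ^+ 2 by rewrite exprn_gt0.
have sqe : Num.sqrt (e ^+ 2) = e by rewrite sqrtr_sqr gtr0_norm.
have pos (x : R) : x \in `]e ^+ 2, +oo[%R -> 0 < x.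
  by rewrite in_itv/= andbT; exact: lt_trans.
have := @increasing_ge0_integration_by_substitutiony R Num.sqrt
  (fun r => 2 * r * f (r ^+ 2)) (e ^+ 2).
rewrite sqe => -> //.
- apply: eq_integral => x; rewrite inE/= in_itv/= andbT => ex.
  have x0 : 0 < x by exact: lt_le_trans ex.
  rewrite !fctE derive1_sqrt// sqr_sqrtr ?ltW//; congr EFin.
  by field; rewrite gt_eqF// sqrtr_gt0.
- move=> x y; rewrite !in_itv/= !andbT => ex ey xy.
  by rewrite ltr_sqrt// (lt_le_trans e20).
- by move=> x /pos; exact: cvg_derive1_sqrt.
- apply/cvg_ex; exists (derive1 (@Num.sqrt R) (e ^+ 2)).
  exact/cvg_at_right_filter/cvg_derive1_sqrt.
- apply/cvg_ex; exists 0.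
  have h : (2 * Num.sqrt x)^-1 @[x --> +oo] --> (0 : R).
    apply/gtr0_cvgV0.
      near=> x; rewrite mulr_gt0// sqrtr_gt0.
      by near: x; exact: nbhs_pinfty_gt.
    apply/cvgryPge => A; near=> x.
    rewrite -ler_pdivrMl//.
    by near: x; move/cvgryPge : cvgy_sqrt; apply.
  apply: cvg_trans h; apply: near_eq_cvg; near=> x.
  have x0 : 0 < x by near: x; exact: nbhs_pinfty_gt.
  by rewrite derive1_sqrt.
- split; last exact/cvg_at_right_filter/sqrt_continuous.
  by move=> x /pos x0; case: (is_derive1_sqrt x0).
- exact: cvgy_sqrt.
- apply: continuous_in_subspaceT => x; rewrite inE/= in_itv/= andbT => ex.
  by apply: continuous_sqr_subst => //; exact: lt_le_trans ex.
- move=> x; rewrite in_itv/= andbT => ex.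
  have x0 : 0 < x by exact: lt_trans ex.
  by apply: mulr_ge0; [rewrite mulr_ge0 ?ltW|apply: f0; rewrite exprn_gt0].
Unshelve. all: by end_near. Qed.

(** Monotone convergence along rays exhausting the open half-line; the bound on
    [u] makes it converge to the origin. *)
Lemma cvg_integral_tail f (u : nat -> R) : measurable_fun (`]0, +oo[ : set R) f ->
  (forall x : R, 0 < x -> 0 <= f x) ->
  (forall k, 0 < u k) -> (forall k, u k <= k.+1%:R^-1) ->
  {homo u : k l / (k <= l)%N >-> l <= k} ->
  (\int[mu]_(x in `[u k, +oo[) (f x)%:E @[k --> \oo] -->
   \int[mu]_(x in `]0%R, +oo[) (f x)%:E)%E.
Proof.
move=> mf f0 u0 u1 nu.
have pos k (x : R) : `[u k, +oo[%classic x -> 0 < x.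
  by rewrite /= in_itv/= andbT; exact: lt_le_trans.
rewrite (_ : `]0, +oo[%classic = \bigcup_k `[u k, +oo[%classic).
  apply: (@ge0_nondecreasing_set_cvg_integral _ (measurableTypeR R) R
    (fun k => `[u k, +oo[%classic) (EFin \o f) mu).
  - move=> k l kl; rewrite subsetEset => x /=; rewrite !in_itv/= !andbT.
    exact/le_trans/nu.
  - by [].
  - move=> k; apply/measurable_EFinP; apply: measurable_funS mf => // x /pos.
    by rewrite /= in_itv/= andbT.
  - by move=> k x /pos x0; rewrite lee_fin f0.
apply/seteqP; split => [x|x [k _ /pos]]; last by rewrite /= in_itv/= andbT.
rewrite (itvoyEbigcup (0 : R)) => -[k _]; rewrite /= in_itv/= andbT add0r => kx.
by exists k => //; rewrite /= in_itv/= andbT (le_trans _ kx).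
Qed.

(** The rays starting at [1/(k+1)] correspond under squaring to the rays starting
    at [1/(k+1)^2]; both families exhaust the half-line, so the two integrals
    are limits of the same sequence. *)
Lemma integral_sqr_pos f : (forall x : R, 0 < x -> {for x, continuous f}) ->
  (forall x : R, 0 < x -> 0 <= f x) ->
  (\int[mu]_(r in `]0%R, +oo[) (2 * r * f (r ^+ 2))%R%:E =
   \int[mu]_(x in `]0%R, +oo[) (f x)%:E)%E.
Proof.
move=> cf f0; pose u k : R := k.+1%:R^-1.
have u0 k : 0 < u k by rewrite invr_gt0.
have nu : {homo u : k l / (k <= l)%N >-> l <= k}.
  by move=> k l kl; rewrite lef_pV2 ?posrE// ler_nat.
have : (\int[mu]_(r in `[u k, +oo[) (2 * r * f (r ^+ 2))%R%:E @[k --> \oo] -->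
        \int[mu]_(r in `]0%R, +oo[) (2 * r * f (r ^+ 2))%R%:E)%E.
  apply: cvg_integral_tail => //.
  - by apply: measurable_pos => x; exact: continuous_sqr_subst.
  - by move=> x x0; apply: mulr_ge0; [rewrite mulr_ge0 ?ltW|apply: f0; rewrite exprn_gt0].
have : (\int[mu]_(r in `[(u k ^+ 2)%R, +oo[) (f r)%:E @[k --> \oo] -->
        \int[mu]_(r in `]0%R, +oo[) (f r)%:E)%E.
  apply: (@cvg_integral_tail _ (fun k => u k ^+ 2)) => //.
  - exact: measurable_pos.
  - by move=> k; rewrite exprn_gt0.
  - move=> k; rewrite expr2 ger_pMl// /u invf_le1// ler1n//.
  - by move=> k l kl; apply: lerXn2r; [rewrite nnegrE ltW|rewrite nnegrE ltW|exact: nu].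
under eq_fun do rewrite -integral_sqr_tail//.
by move=> h1 h2; rewrite -(cvg_lim _ h1)// -(cvg_lim _ h2).
Qed.

(** Since [f >= 0], integrability is finiteness of the integral, so it is
    carried over by the extended-real identity. *)
Lemma Rintegral_sqr_pos f : (forall x : R, 0 < x -> {for x, continuous f}) ->
  (forall x : R, 0 < x -> 0 <= f x) ->
  mu.-integrable (`]0, +oo[ : set R) (EFin \o f) ->
  mu.-integrable (`]0, +oo[ : set R) (EFin \o (fun r => 2 * r * f (r ^+ 2))) /\
  \int[mu]_(r in `]0, +oo[) (2 * r * f (r ^+ 2)) =
  \int[mu]_(x in `]0, +oo[) f x.
Proof.
move=> cf f0 fi; split; last by rewrite /Rintegral integral_sqr_pos.
apply/integrableP; split.
  apply/measurable_EFinP; apply: measurable_pos => x; exact: continuous_sqr_subst.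
have /integrableP[_] := fi; congr (_ < _)%E.
transitivity (\int[mu]_(x in `]0%R, +oo[) (f x)%:E)%E.
  apply: eq_integral => x; rewrite inE/= in_itv/= andbT => x0.
  by rewrite ger0_norm// f0.
rewrite -integral_sqr_pos//.
apply: eq_integral => x; rewrite inE/= in_itv/= andbT => x0.
rewrite ger0_norm//; apply: mulr_ge0; first by rewrite mulr_ge0 ?ltW.
by apply: f0; rewrite exprn_gt0.
Qed.

End SquareSubstitution.

(** * The kernels in terms of moments and derivatives of the weight *)

Section Kernel.
Context {R : realType}.
Local Notation mu := (@lebesgue_measure R).
Variable omega : R -> R.
Local Notation M k := (mellin omega k.+1%:R).

Lemma normc_sqr (a b : R) : Normc.normc (a +i* b) ^+ 2 = a ^+ 2 + b ^+ 2.
Proof. by rewrite /Normc.normc sqr_sqrtr// addr_ge0// sqr_ge0. Qed.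

(** Both arguments have modulus [r], so the square root is that of the square of
    [omega (r ^+ 2)], which is [omega (r ^+ 2)] itself by positivity. *)
Lemma K_ev_circle n (r phi : R) : 0 <= omega (r ^+ 2) ->
  K_ev omega n r%:C (r%:C * expi (- phi)) =
  \sum_(j < n) (omega (r ^+ 2) * (r ^+ 2) ^+ j / (pi * M j))%:C *
    expi (- phi) ^+ j.
Proof.
move=> w0; rewrite /K_ev.
have -> : r%:C * expi (- phi) = (r * cos phi) +i* (- (r * sin phi)).
  by apply/eqP; rewrite eq_complex /expi/= cosN sinN !mul0r subr0 addr0 mulrN !eqxx.
rewrite !normc_sqr expr0n/= addr0 sqrrN !exprMn -mulrDr cos2Dsin2 mulr1.
rewrite -expr2 sqrtr_sqr ger0_norm// mulr_sumr; apply: eq_bigr => j _.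
have -> : r%:C * ((r * cos phi) +i* (- (r * sin phi))) =
    (r ^+ 2)%:C * expi (- phi).
  apply/eqP; rewrite eq_complex /expi/= cosN sinN !mul0r !subr0 !addr0.
  by apply/andP; split; apply/eqP; ring.
by rewrite exprMn -rmorphXn/= !rmorphM/= fmorphV rmorphM/=; ring.
Qed.

(** The common form of all the angular integrals of the theorem. *)
Lemma K_ev_circle_integral n l (u v r : R) : (l < n)%N -> 0 <= omega (r ^+ 2) ->
  Cintegral `[- pi, pi] (fun phi : R => (u%:C * expi phi + v%:C) ^+ l *
    K_ev omega n r%:C (r%:C * expi (- phi))) =
  (\sum_(k < l.+1) 2 * 'C(l, k)%:R * u ^+ k * v ^+ (l - k) / M k *
     ((r ^+ 2) ^+ k * omega (r ^+ 2)))%:C.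
Proof.
move=> ln w0.
transitivity (Cintegral `[- pi, pi] (fun phi : R =>
    (\sum_(k < l.+1) ('C(l, k)%:R * u ^+ k * v ^+ (l - k))%:C * expi phi ^+ k) *
    (\sum_(j < n) (omega (r ^+ 2) * (r ^+ 2) ^+ j / (pi * M j))%:C *
      expi (- phi) ^+ j))).
  apply: eq_Cintegral => phi _; rewrite K_ev_circle//; congr (_ * _).
  rewrite addrC exprDn; apply: eq_bigr => k _.
  rewrite exprMn -!rmorphXn/= !rmorphM/= rmorph_nat -mulr_natl; ring.
rewrite (Cintegral_angular
  (fun k => 'C(l, k)%:R * u ^+ k * v ^+ (l - k))
  (fun j => omega (r ^+ 2) * (r ^+ 2) ^+ j / (pi * M j)) ln).
congr (_%:C); rewrite mulr_sumr; apply: eq_bigr => k _.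
have pi0 : (pi : R) != 0 by rewrite gt_eqF// pi_gt0.
(* pi is abstracted lest [field] unfold it *)
by rewrite invfM; move: (M k)^-1 pi pi0 => m p p0; field.
Qed.

Lemma triangle_sum n (f : nat -> nat -> R) :
  \sum_(j < n) \sum_(k < j.+1) f k j =
  \sum_(k < n) \sum_(i < n - k) f k (k + i)%N.
Proof.
elim: n => [|n IH]; first by rewrite !big_ord0.
rewrite big_ord_recr/= {}IH [in RHS]big_ord_recr/= subSnn big_ord1 addn0.
rewrite big_ord_recr/= addrA -big_split/=; congr (_ + _).
apply: eq_bigr => k _; rewrite subSn ?(ltnW (ltn_ord k))// big_ord_recr/=.
by rewrite subnKC// ltnW.
Qed.

Lemma derive1n_oppX l (c : R) : derivable_pos l omega -> 0 < c ->
  derive1n l (fun x => (- x) ^+ l * omega x) c =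
  (-1) ^+ l * derive1n l (fun x => x ^+ l * omega x) c.
Proof.
move=> dw c0; have dxw : derivable_pos l (fun x => x ^+ l * omega x).
  by apply: derivable_posM; [exact: derivable_pos_exp|exact: dw].
rewrite -(derive1n_posZ _ dxw c0).
by apply: derive1n_pos_eq => // x x0; rewrite mulrA -exprMn mulN1r.
Qed.

(** The function of which [K_sv] is, up to the factor [2 (n-1)!], the n-th
    derivative: the double integral of the kernel formulas, with the radial
    integral of [x^k omega] replaced by an arbitrary [W k]. *)
Definition kernel_primitive n (W : nat -> R -> R) (b t : R) : R :=
  \sum_(k < n) 2 * 'C(n.-1, k)%:R * (- b) ^+ k * t ^+ (n.-1 - k) / M k * W k t.

(** The alternating signs of [p_j] and of [(-x)^j] cancel up to [(-1)^k], so that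
    [K_sv] is a sum over [k <= j < n] of [(-b)^k / (k! M(k+1))] times
    [(d/dc)^j [c^j omega(c)] / (j-k)!]. Summing over [j] first, each inner sum
    is one n-th derivative by [derive1n_antiderivative].  Smoothness of the
    primitive is part of the conclusion because it is needed to change its sign
    under the derivative. *)
Lemma K_sv_primitive n (W : nat -> R -> R) (b c : R) : (0 < n)%N ->
  (forall k, (k < n)%N -> M k != 0) -> derivable_pos n omega ->
  (forall k (t : R), (k < n)%N -> 0 < t ->
     is_derive t (1 : R) (W k) (t ^+ k * omega t)) -> 0 < c ->
  derivable_pos n (kernel_primitive n W b) /\
  K_sv omega n b c =
    (2 * (n.-1)`!%:R)^-1 * derive1n n (kernel_primitive n W b) c.
Proof.
move=> n0 M0 dw dW c0.
pose D j := derive1n j (fun x => x ^+ j * omega x) c.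
pose f k j := (- b) ^+ k / (k`!%:R * M k) * (D j / (j - k)`!%:R).
have fact0 k : (k`!%:R : R) != 0 by rewrite pnatr_eq0 -lt0n fact_gt0.
pose F (k : nat) (t : R) := t ^+ (n.-1 - k) / (n.-1 - k)`!%:R * W k t.
have dWk (k : 'I_n) : derivable_pos n (W k).
  apply: (derivable_posW (leqnSn n)).
  apply: (derivable_posS (fun t => @dW k t (ltn_ord k))).
  by apply: derivable_posM; [exact: derivable_pos_exp|exact: dw].
have dF (k : 'I_n) : derivable_pos n (F k).
  apply: derivable_posM; last exact: dWk.
  by apply: derivable_posM; [exact: derivable_pos_exp|exact: derivable_pos_cst].
pose G (k : 'I_n) (t : R) := (2 * (n.-1)`!%:R * ((- b) ^+ k / (k`!%:R * M k))) * F k t.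
have dG (k : 'I_n) : derivable_pos n (G k).
  by apply: derivable_posM; [exact: derivable_pos_cst|exact: dF].
rewrite (_ : kernel_primitive n W b = (fun t => \sum_(k < n) G k t)); last first.
  apply/funext => t; apply: eq_bigr => k _; rewrite /G /F.
  have kn : (k <= n.-1)%N by rewrite -ltnS prednK.
  rewrite -(bin_fact kn) !natrM.
  move: (M k) (M0 k (ltn_ord k)) => Mk Mk0.
  by field; rewrite !fact0 Mk0.
split; first exact: derivable_pos_sum.
transitivity (\sum_(j < n) \sum_(k < j.+1) f k j).
  apply: eq_bigr => j _; rewrite /p_sv /q_sv mulr_suml; apply: eq_bigr => k _.
  rewrite derive1n_oppX//; last exact: derivable_posW (ltnW (ltn_ord j)) dw.
  rewrite -/(D j) /f [(- b) ^+ k]exprNn.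
  have kj : (k <= j)%N by rewrite -ltnS.
  have -> : (-1) ^+ j = (-1) ^+ (j - k) * (-1) ^+ k :> R.
    by rewrite -exprD subnK.
  have s1 : ((-1) ^+ (j - k) : R) * (-1) ^+ (j - k) = 1.
    by rewrite -exprMn mulrNN mulr1 expr1n.
  have Mj := M0 j (ltn_ord j).
  have Mk := M0 k (leq_ltn_trans kj (ltn_ord j)).
  (* isolate the square of the sign (-1)^(j-k), which [field] cannot see to be 1 *)
  transitivity (((-1) ^+ (j - k) * (-1) ^+ (j - k)) *
    ((-1) ^+ k * b ^+ k / (k`!%:R * M k) * (D j / (j - k)`!%:R))).
    move: (M j) (M k) Mj Mk => Mj Mk Mj0 Mk0.
    by field; rewrite !fact0 Mj0 Mk0.
  by rewrite s1 mul1r.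
rewrite triangle_sum.
rewrite (derive1n_pos_sum _ dG c0) mulr_sumr; apply: eq_bigr => k _.
rewrite (derive1n_posZ _ (dF k) c0) !mulrA.
have -> : (2 * (n.-1)`!%:R)^-1 * 2 * (n.-1)`!%:R = 1 :> R by field; exact: fact0.
rewrite mul1r /f -mulr_sumr; congr (_ * _).
have kn : (k <= n.-1)%N by rewrite -ltnS prednK.
have nE : n = (n.-1 - k + k).+1 by rewrite subnK// prednK.
have -> : derive1n n (F k) c = derive1n (n.-1 - k + k).+1 (F k) c.
  by congr (derive1n _ _ c).
have dwk : derivable_pos (n.-1 - k + k) omega.
  by apply: derivable_posW dw; rewrite [leqRHS]nE.
rewrite /F (derive1n_antiderivative dwk (fun t => @dW k t (ltn_ord k)) c0).
rewrite -subSn// prednK//; apply: eq_bigr => i _.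
by rewrite addKn.
Qed.

End Kernel.

(** * Moments of the weight and their antiderivatives *)

Section Moments.
Context {R : realType}.
Local Notation mu := (@lebesgue_measure R).
Implicit Type f : R -> R.

Lemma mellin_natE (omega : R -> R) k :
  mellin omega k.+1%:R = \int[mu]_(y in `]0, +oo[) (y ^+ k * omega y).
Proof.
apply: eq_Rintegral => y; rewrite inE/= in_itv/= andbT => y0.
by rewrite -natr1 addrK powR_mulrn ?ltW// mulrC.
Qed.

Lemma L1k_moment_integrable (m k : nat) (I : set R) (omega : R -> R) : L1k m I omega ->
  I k.+1%:R ->
  mu.-integrable (`]0, +oo[ : set R) (EFin \o (fun y => y ^+ k * omega y)).
Proof.
move=> [_ _ /(_ k.+1%:R 0%N)] + Ik => /(_ Ik (leq0n _)).
apply: eq_integrable => // y; rewrite inE/= in_itv/= andbT => y0.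
by rewrite -natr1 addrK powR_mulrn ?ltW.
Qed.

(** A non-negative integrand of integral zero vanishes almost everywhere, and
    [y^k > 0], so [omega] would vanish almost everywhere. *)
Lemma mellin_nat_neq0 (omega : R -> R) k : positive_weight omega ->
  mu.-integrable (`]0, +oo[ : set R) (EFin \o (fun y => y ^+ k * omega y)) ->
  mellin omega k.+1%:R != 0.
Proof.
move=> [w0 wn0] iw; rewrite mellin_natE; apply: contra_notN wn0 => /eqP M0.
have : (\int[mu]_(y in `]0%R, +oo[) `|(y ^+ k * omega y)%:E| = 0)%E.
  transitivity (\int[mu]_(y in `]0%R, +oo[) (y ^+ k * omega y)%:E)%E.
    apply: eq_integral => y; rewrite inE/= in_itv/= andbT => y0.
    by rewrite ger0_norm// mulr_ge0 ?w0// exprn_ge0// ltW.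
  rewrite -(@fineK _ (\int[mu]_(y in _) _)%E); first by move: M0; rewrite /Rintegral => ->.
  exact: integrable_fin_num.
have mw : measurable_fun (`]0, +oo[ : set (measurableTypeR R))
    (EFin \o (fun y => y ^+ k * omega y)) by case/integrableP: iw.
move=> /(ae_eq_integral_abs mu (measurable_itv _) mw).1.
apply: filterS => y h y0.
have /h : (`]0, +oo[ : set R) y by rewrite /= in_itv/= y0.
by case => /eqP; rewrite mulf_eq0 expf_eq0 (gt_eqF y0) andbF/= => /eqP.
Qed.

Lemma is_derive_integral_lower f (t : R) :
  mu.-integrable (`]0, +oo[ : set R) (EFin \o f) ->
  0 < t -> {for t, continuous f} ->
  is_derive t (1 : R) (fun t => \int[mu]_(x in `]0, t[) f x) (f t).
Proof.
move=> fi t0 ft.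
have sub (b : bool) (u : R) : mu.-integrable [set` Interval (BRight 0) (BSide b u)] (EFin \o f).
  apply: integrableS fi => //; exact: subset_itvl.
have tt1 : t < t + 1 by rewrite ltrDl.
have [d1 d2] := @continuous_FTC1 R f (BRight 0) t (t + 1) tt1 (sub false _) t0 ft.
rewrite (_ : (fun t => _) = (fun t => \int[mu]_(x in `]0, t]) f x)).
  by apply: DeriveDef; [exact: d1|rewrite -derive1E; exact: d2].
by apply/funext => u; rewrite Rintegral_itv_bndo_bndc//; exact: sub.
Qed.

(** It differs from the integral over [(0, t)] by the constant total
    integral. *)
Lemma is_derive_integral_upper f (t : R) :
  mu.-integrable (`]0, +oo[ : set R) (EFin \o f) ->
  0 < t -> {for t, continuous f} ->
  is_derive t (1 : R) (fun t => - \int[mu]_(x in `]t, +oo[) f x) (f t).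
Proof.
move=> fi t0 ft.
pose c := \int[mu]_(x in `]0, +oo[) f x.
apply: (@near_eq_is_derive _ _ _ ((fun t => \int[mu]_(x in `]0, t[) f x) - cst c)).
  apply: (near_pos _ t0) => u u0; rewrite fctE /cst.
  rewrite -(@Rintegral_itvB _ f (BRight 0) +oo%O u)// ?bnd_simp ?ltW//.
  rewrite opprB Rintegral_itv_bndo_bndc//.
  by apply: integrableS fi => //; exact: subset_itvl.
rewrite -[f t]subr0; apply: is_deriveB; exact: is_derive_integral_lower.
Qed.

End Moments.

(** * The three integral representations *)

Section Representations.
Context {R : realType}.
Local Notation mu := (@lebesgue_measure R).

(** [l!/(k!(l-k)!)] is a binomial coefficient, and the factor [M(l+1)] common to
    all terms is what the radial integral will produce. *)
Lemma p_sv_moment (omega : R -> R) l (a : R) :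
  p_sv omega l a =
  (\sum_(k < l.+1) 'C(l, k)%:R * a ^+ k * (-1) ^+ (l - k) / mellin omega k.+1%:R) *
  mellin omega l.+1%:R.
Proof.
rewrite /p_sv mulr_suml; apply: eq_bigr => k _.
have kl : (k <= l)%N by rewrite -ltnS.
have fact0 j : (j`!%:R : R) != 0 by rewrite pnatr_eq0 -lt0n fact_gt0.
rewrite -(bin_fact kl) !natrM !invfM.
move: (mellin omega k.+1%:R)^-1 (mellin omega l.+1%:R) => Mk Ml.
by field; rewrite !fact0.
Qed.

(** Each term of the angular integral contains [r^{2(l-k)}] from the binomial
    and [r^{2k}] from the kernel, so the radial integral is the same for
    all [k]. *)
Lemma p_sv_integral_K_ev (n l : nat) (omega : R -> R) (a : R) : (l < n)%N ->
  (forall x : R, 0 < x -> 0 <= omega x) ->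
  (forall x : R, 0 < x -> {for x, continuous omega}) ->
  mu.-integrable (`]0, +oo[ : set R) (EFin \o (fun y => y ^+ l * omega y)) ->
  (p_sv omega l a)%:C =
  Cintegral `]0, +oo[ (fun r : R =>
    Cintegral `[- pi, pi] (fun phi : R =>
      (a%:C * expi phi - (r ^+ 2)%:C) ^+ l *
      K_ev omega n r%:C (r%:C * expi (- phi))) * r%:C).
Proof.
move=> ln w0 cw iw.
pose f y := y ^+ l * omega y.
have cf (x : R) : 0 < x -> {for x, continuous f}.
  by move=> x0; apply: cvgM; [exact: exprn_continuous|exact: cw].
have f0 (x : R) : 0 < x -> 0 <= f x.
  by move=> x0; rewrite mulr_ge0 ?w0// exprn_ge0// ltW.
pose S := \sum_(k < l.+1) 'C(l, k)%:R * a ^+ k * (-1) ^+ (l - k) / mellin omega k.+1%:R.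
have [fi2 fE] := Rintegral_sqr_pos cf f0 iw.
transitivity (Cintegral `]0, +oo[ (fun r : R => (S * (2 * r * f (r ^+ 2)))%:C)).
  rewrite Cintegral_real RintegralZl// fE -mellin_natE.
  by rewrite p_sv_moment.
apply: eq_Cintegral => r; rewrite inE/= in_itv/= andbT => r0.
have r20 : 0 < r ^+ 2 by rewrite exprn_gt0.
under eq_Cintegral do rewrite -rmorphN/=.
rewrite K_ev_circle_integral// ?w0// -rmorphM/=; congr (_%:C).
rewrite /S !mulr_suml; apply: eq_bigr => k _.
have kl : (k <= l)%N by rewrite -ltnS.
rewrite [(- r ^+ 2) ^+ _]exprNn /f.
have -> : (r ^+ 2) ^+ l = (r ^+ 2) ^+ (l - k) * (r ^+ 2) ^+ k.
  by rewrite -exprD subnK.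
by move: (mellin _ _)^-1 => m; ring.
Qed.

(** The mode [e^{i l phi}] selects the coefficient of index [l] of the kernel. *)
Lemma q_sv_derivative_K_ev (n l : nat) (omega : R -> R) (a : R) : (l < n)%N -> 0 < a ->
  (forall x : R, 0 < x -> 0 <= omega x) -> derivable_pos l omega ->
  (q_sv omega l a)%:C =
  (2 * (l`!)%:R)^-1 * ((-1) ^+ l *
  Cderiven l (fun x : R =>
    Cintegral `[- pi, pi] (fun phi : R =>
      expi (l%:R * phi) *
      K_ev omega n (Num.sqrt x)%:C ((Num.sqrt x)%:C * expi (- phi)))) a).
Proof.
move=> ln a0 w0 dw.
pose h x := 2 / mellin omega l.+1%:R * (x ^+ l * omega x).
rewrite (@Cderiven_pos_real _ _ _ h)//; last first.
  move=> x x0; have sx : Num.sqrt x ^+ 2 = x by rewrite sqr_sqrtr// ltW.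
  (* e^{i l phi} as the binomial power (1 * e^{i phi} + 0)^l *)
  transitivity (Cintegral `[- pi, pi] (fun phi : R =>
    ((1 : R)%:C * expi phi + (0 : R)%:C) ^+ l *
      K_ev omega n (Num.sqrt x)%:C ((Num.sqrt x)%:C * expi (- phi)))).
    by apply: eq_Cintegral => phi _; rewrite mul1r addr0 expiMn.
  rewrite K_ev_circle_integral// sx ?w0//; congr (_%:C).
  rewrite big_ord_recr/= big1 ?add0r => [|k _].
    by rewrite binn subnn expr1n expr0 !mulr1.
  by rewrite [0 ^+ _]expr0n subn_eq0 leqNgt ltn_ord/= mulr0 !mul0r.
have dxw : derivable_pos l (fun x => x ^+ l * omega x).
  by apply: derivable_posM; [exact: derivable_pos_exp|exact: dw].
rewrite /h (derive1n_posZ _ dxw a0) /q_sv (derive1n_oppX dw a0).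
have realE (z : R) : (2 * (l`!)%:R)^-1 * ((-1) ^+ l * z%:C) =
    ((2 * (l`!)%:R)^-1 * ((-1) ^+ l * z))%:C :> R[i].
  rewrite [in RHS]rmorphM/= fmorphV rmorphM/= !rmorph_nat.
  by rewrite [in RHS]rmorphM/= rmorphXn/= rmorphN1.
rewrite realE; congr (_%:C); rewrite !invfM.
have fact0 : (l`!%:R : R) != 0 by rewrite pnatr_eq0 -lt0n fact_gt0.
by move: (mellin _ _)^-1 => m; field.
Qed.

(** Stated for any subset [D] of the half-line, so as to serve for both [(0, t)]
    and [(t, oo)]: [t] enters the integrand only through the coefficients, and
    the moments over [D] play the role of [W k]. *)
Lemma double_integral_K_ev (n : nat) (omega : R -> R) (D : set R) (b t : R) :
  (0 < n)%N -> (forall x : R, 0 < x -> 0 <= omega x) ->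
  measurable D -> D `<=` `]0, +oo[ ->
  (forall k, (k < n)%N -> mu.-integrable D (EFin \o (fun y => y ^+ k * omega y))) ->
  Cintegral D (fun x : R =>
    Cintegral `[- pi, pi] (fun phi : R =>
      K_ev omega n (Num.sqrt x)%:C ((Num.sqrt x)%:C * expi (- phi)) *
      (t%:C - b%:C * expi phi) ^+ n.-1)) =
  (kernel_primitive omega n
     (fun k _ => \int[mu]_(x in D) (x ^+ k * omega x)) b t)%:C.
Proof.
move=> n0 w0 mD D0 iw.
pose c k := 2 * 'C(n.-1, k)%:R * (- b) ^+ k * t ^+ (n.-1 - k) / mellin omega k.+1%:R.
transitivity (Cintegral D (fun x : R =>
    \sum_(k < n) (c k)%:C * (x ^+ k * omega x)%:C)).
  apply: eq_Cintegral => x; rewrite inE => /D0/=; rewrite in_itv/= andbT => x0.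
  have sx : Num.sqrt x ^+ 2 = x by rewrite sqr_sqrtr// ltW.
  transitivity (Cintegral `[- pi, pi] (fun phi : R =>
    ((- b)%:C * expi phi + t%:C) ^+ n.-1 *
      K_ev omega n (Num.sqrt x)%:C ((Num.sqrt x)%:C * expi (- phi)))).
    by apply: eq_Cintegral => phi _; rewrite rmorphN/= mulNr addrC mulrC.
  rewrite K_ev_circle_integral ?prednK// sx ?w0// rmorph_sum/=.
  by apply: eq_bigr => k _; rewrite [LHS]rmorphM.
have iC (k : 'I_n) : Cintegrable D (fun x : R => (x ^+ k * omega x)%:C).
  by split; [exact: iw|exact: integrable0].
have [_ ->] := @Cintegral_sum R D _ (index_enum 'I_n) _ mD
  (fun k : 'I_n => CintegrableZl (c k) mD (iC k)).
rewrite /kernel_primitive rmorph_sum/=; apply: eq_bigr => k _.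
by rewrite CintegralZl// Cintegral_real -rmorphM.
Qed.

End Representations.

Theorem theorem4p5 (R : realType) (n : nat) (smin smax : \bar R)
    (omega : R -> R)
    (n_gt0 : (0 < n)%N)
    (sub_itv : `[1, n.+1%:R] `<=` open_itv smin smax)
    (omega_L1 : L1k n.-1 (open_itv smin smax) omega)
    (omega_pos : positive_weight omega)
    (omega_Cn : Ck n omega) :
  (* (a) *)
  (forall (l : nat) (a : R), (l < n)%N -> 0 < a ->
     (p_sv omega l a)%:C =
     Cintegral `]0, +oo[ (fun r : R =>
       Cintegral `[- pi, pi] (fun phi : R =>
         (a%:C * expi phi - (r ^+ 2)%:C) ^+ l *
         K_ev omega n r%:C (r%:C * expi (- phi))) * r%:C)) /\
  (* (b) *)
  (forall (l : nat) (a : R), (l < n)%N -> 0 < a ->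
     (q_sv omega l a)%:C =
     (2 * (l`!)%:R)^-1 * ((-1) ^+ l *
     Cderiven l (fun x : R =>
       Cintegral `[- pi, pi] (fun phi : R =>
         expi (l%:R * phi) *
         K_ev omega n (Num.sqrt x)%:C ((Num.sqrt x)%:C * expi (- phi)))) a)) /\
  (* (c) *)
  (forall b c : R, 0 < b -> 0 < c ->
     (K_sv omega n b c)%:C =
       (2 * ((n.-1)`!)%:R)^-1 *
       Cderiven n (fun t : R =>
         Cintegral `]0, t[ (fun x : R =>
           Cintegral `[- pi, pi] (fun phi : R =>
             K_ev omega n (Num.sqrt x)%:C ((Num.sqrt x)%:C * expi (- phi)) *
             (t%:C - b%:C * expi phi) ^+ n.-1))) c /\
     (K_sv omega n b c)%:C =
       - (2 * ((n.-1)`!)%:R)^-1 *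
       Cderiven n (fun t : R =>
         Cintegral `]t, +oo[ (fun x : R =>
           Cintegral `[- pi, pi] (fun phi : R =>
             K_ev omega n (Num.sqrt x)%:C ((Num.sqrt x)%:C * expi (- phi)) *
             (t%:C - b%:C * expi phi) ^+ n.-1))) c).
Proof.
have w0 := omega_pos.1.
have dw : derivable_pos n omega := omega_Cn.1.
have cw (x : R) : 0 < x -> {for x, continuous omega}.
  by move=> x0; apply/differentiable_continuous/derivable1_diffP/(dw 0%N).
have iw k : (k < n)%N -> lebesgue_measure.-integrable (`]0, +oo[ : set R)
    (EFin \o (fun y => y ^+ k * omega y)).
  move=> kn; apply: (L1k_moment_integrable omega_L1); apply: sub_itv.
  by rewrite /= in_itv/= ler1n ler_nat; exact: ltnW.
have M0 k : (k < n)%N -> mellin omega k.+1%:R != 0.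
  by move=> kn; apply: mellin_nat_neq0 => //; exact: iw.
have cxw k (x : R) : 0 < x -> {for x, continuous (fun y : R => y ^+ k * omega y)}.
  by move=> x0; apply: cvgM; [exact: exprn_continuous|exact: cw].
split; [|split].
- by move=> l a ln a0; apply: p_sv_integral_K_ev => //; exact: iw.
- by move=> l a ln a0; apply: q_sv_derivative_K_ev => //; apply: derivable_posW dw; exact: ltnW.
move=> b c b0 c0.
have twoE (z : R) : (2 * ((n.-1)`!)%:R)^-1 * z%:C =
    ((2 * ((n.-1)`!)%:R)^-1 * z)%:C :> R[i].
  by rewrite [in RHS]rmorphM/= fmorphV rmorphM/= !rmorph_nat.
split.
- pose W k (t : R) := \int[lebesgue_measure]_(x in `]0, t[) (x ^+ k * omega x).
  rewrite (@Cderiven_pos_real _ _ _ (kernel_primitive omega n W b))//; last first.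
    move=> t t0; rewrite double_integral_K_ev//; first exact: subset_itvl.
    by move=> k kn; apply: integrableS (iw k kn) => //; exact: subset_itvl.
  rewrite twoE; congr (_%:C).
  apply: (K_sv_primitive b n_gt0 M0 dw _ c0).2 => k t kn t0.
  exact: is_derive_integral_lower (iw k kn) t0 (cxw k t t0).
- pose W k (t : R) := - \int[lebesgue_measure]_(x in `]t, +oo[) (x ^+ k * omega x).
  have dW k (t : R) : (k < n)%N -> 0 < t ->
      is_derive t (1 : R) (W k) (t ^+ k * omega t).
    move=> kn t0.
    exact: is_derive_integral_upper (iw k kn) t0 (cxw k t t0).
  have [dK ->] := K_sv_primitive b n_gt0 M0 dw dW c0.
  rewrite (@Cderiven_pos_real _ _ _ (fun t => -1 * kernel_primitive omega n W b t))//.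
    by rewrite mulNr twoE (derive1n_posZ _ dK c0) mulN1r mulrN rmorphN/= opprK.
  move=> t t0.
  have tsub : (`]t, +oo[ : set R) `<=` `]0, +oo[.
    by apply: subset_itvr; rewrite bnd_simp ltW.
  rewrite double_integral_K_ev//; last first.
    by move=> k kn; apply: integrableS (iw k kn).
  congr (_%:C); rewrite mulN1r /kernel_primitive -sumrN; apply: eq_bigr => k _.
  by rewrite /W mulrN opprK.
Qed.
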